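(* Let $\mathbb{F}_q$ be a finite field of characteristic $p$, $a,b\in\mathbb{F}_q$ with $b\neq0$, and $Q=\begin{pmatrix} a & b\\ 1 & 0\end{pmatrix}$. Suppose $x^2-ax-b$ has a repeated root $\gamma\in\mathbb{F}_q$ of multiplicative order $l$. Then $G=\langle Q\rangle$ acting on $\mathbb{F}_q\times\mathbb{F}_q$ has $\frac{q-1}{l}$ orbits of length $l$ and $\frac{q(q-1)}{pl}$ orbits of length $pl$.
   Context: $G=\langle Q\rangle$ acts on $\mathbb{F}_q\times\mathbb{F}_q$ (column vectors) by $v\mapsto Q^nv$; orbit length is the number of elements of the orbit.
   Formalization: Orbits are counted without the zero orbit {0}: when l = 1 (γ = 1) the literal count of orbits of length l is q, not (q−1)/l = q−1; for l > 1 and for length pl leaving out {0} changes nothing. *)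

(* Defs.v *)
From mathcomp Require Import all_boot all_order all_fingroup all_algebra.

Set Implicit Arguments.
Unset Strict Implicit.
Unset Printing Implicit Defensive.

Import GRing.Theory.
Local Open Scope ring_scope.

Definition Qmx (F : finFieldType) (a b : F) : 'M[F]_2 :=
  \matrix_(i < 2, j < 2) (nth [::] [:: [:: a; b]; [:: 1; 0]] i)`_j.

Lemma det_Qmx (F : finFieldType) (a b : F) : \det (Qmx a b) = - b.
Proof.
rewrite (expand_det_row _ ord_max) !big_ord_recl big_ord0 /cofactor !det_mx11.
by rewrite !mxE /= mul0r !addr0 mul1r expr1 mulN1r.
Qed.

Lemma Qmx_unit (F : finFieldType) (a b : F) :
  b != 0 -> Qmx a b \is a GRing.unit.
Proof.
by move=> hb; have := unitmxE (Qmx a b); rewrite det_Qmx unitrN unitfE hb.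
Qed.

Definition Qgl (F : finFieldType) (a b : F) (hb : b != 0) : {'GL_2[F]} :=
  FinRing.unit _ (Qmx_unit a hb).

(* Left multiplication of column vectors, [g |-> (v |-> g *m v)].  The library's
   actions are right actions, so on all of GL_2 this is not an action in its
   sense; on the abelian group generated by a single [g] it is one. *)
Definition mulcol (F : finFieldType) (v : 'cV[F]_2) (g : {'GL_2[F]}) :
  'cV[F]_2 := GLval g *m v.

Lemma mulcol_is_action (F : finFieldType) (g : {'GL_2[F]}) :
  is_action <[g]> (@mulcol F).
Proof.
split=> [h u v /(congr1 (mulmx (GLval h^-1)))|v h k hg kg].
  by rewrite /mulcol !mulmxA GL_VE mulVmx ?GL_unitmx ?mul1mx.
have -> : (h * k = k * h)%g by apply: (centsP (cycle_abelian g)).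
by rewrite /mulcol mulmxA -GL_MxE.
Qed.

Definition cyc_act (F : finFieldType) (g : {'GL_2[F]}) :
  action <[g]>%g 'cV[F]_2 :=
  Action (mulcol_is_action g).

(* [{0}] is always an orbit, of length 1; it is left out here so that it is not
   counted among the orbits of length [m] when [m = 1]. *)
Definition nontrivial_orbits_of_length (F : finFieldType) (g : {'GL_2[F]})
    (m : nat) : {set {set 'cV[F]_2}} :=
  [set O in (orbit (cyc_act g) <[g]> @: [set: 'cV[F]_2]) :\ [set 0]
     | #|O| == m].

(* Main.v *)
Require Import Defs.
From mathcomp Require Import all_boot all_order all_fingroup all_algebra.
From mathcomp Require Import ring.

Set Implicit Arguments.
Unset Strict Implicit.
Unset Printing Implicit Defensive.

Import GRing.Theory.
Local Open Scope ring_scope.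

(** Put N = Q - gamma.  The repeated root gives N^2 = 0, hence
    Q^n = gamma^n (1 + (n / gamma) N).  A nonzero v is therefore fixed by Q^n iff
    gamma^n = 1 when N v = 0, and iff moreover p divides n when N v <> 0; since l
    is coprime to p, the orbit lengths are l and p l respectively.  As N has rank
    one, its kernel has q elements, and each count is the number of vectors
    divided by the orbit length. *)

(** The hypothesis says that the exponents fixing [x] are the multiples of [m], so the images of [x]
    under [g ^+ i], [i < m], list the orbit without repetition. *)
Lemma card_orbit_cycle (aT : finGroupType) (T : finType) (g : aT)
    (to : action <[g]>%g T) (x : T) (m : nat) :
    (0 < m)%N -> (forall n, (to x (g ^+ n)%g == x) = (m %| n)%N) ->
  #|orbit to <[g]>%g x| = m.
Proof.
move=> m_gt0 fixE.
have ming n : (g ^+ n)%g \in <[g]>%g by apply: mem_cycle.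
have toD i j : to x (g ^+ (i + j))%g = to (to x (g ^+ i)%g) (g ^+ j)%g.
  by rewrite expgD actMin.
have toB i j : (i <= j)%N ->
    to x (g ^+ i)%g = to x (g ^+ j)%g -> (m %| j - i)%N.
  move=> leij eqij; rewrite -fixE; apply/eqP.
  by apply: (act_inj to (g ^+ i)%g); rewrite -toD subnK.
have -> : orbit to <[g]>%g x = [set to x (g ^+ (i : 'I_m))%g | i : 'I_m].
  apply/setP=> y; apply/orbitP/imsetP=> [[_ /cycleP[n ->] <-]|[i _ ->]]; last first.
    by exists (g ^+ i)%g.
  exists (Ordinal (ltn_pmod n m_gt0)) => //=.
  rewrite {1}(divn_eq n m) toD; congr (to _ _); apply/eqP.
  by rewrite fixE dvdn_mull.
rewrite card_imset ?card_ord // => i j eqij; apply/val_inj/eqP.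
wlog leij : i j eqij / (i <= j)%N.
  by move=> W; case/orP: (leq_total i j) => /W; last rewrite eq_sym; apply.
(* By [toB], [m] divides [j - i], which is less than [m] and therefore zero. *)
rewrite eqn_leq leij /= -subn_eq0; apply: contraLR (toB _ _ leij eqij).
rewrite -lt0n => ltij; rewrite gtnNdvd //.
exact: leq_ltn_trans (leq_subr i j) (ltn_ord j).
Qed.

Section CycAct.
Variables (F : finFieldType) (g : {'GL_2[F]}).

Lemma cyc_actE (v : 'cV[F]_2) n :
  cyc_act g v (g ^+ n)%g = (GLval g ^+ n : 'M_2) *m v.
Proof.
rewrite /= /mulcol; congr (_ *m _).
by elim: n => [|n IHn]; rewrite ?expg0 ?expr0 ?GL_1E // expgS GL_ME IHn exprS.
Qed.

Lemma orbit_cyc_act0 : orbit (cyc_act g) <[g]> 0 = [set 0].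
Proof.
apply/setP=> w; rewrite inE; apply/orbitP/eqP => [[h _ <-]|->].
  by rewrite /= /mulcol mulmx0.
by exists 1%g; rewrite ?group1 // act1.
Qed.

(** Orbit length is constant along an orbit, and the zero vector is alone in its orbit, so both
    conditions on [v] select whole orbits. *)
Lemma nontrivial_orbits_partition m :
  partition (nontrivial_orbits_of_length g m)
    [set v | (v != 0) && (#|orbit (cyc_act g) <[g]> v| == m)].
Proof.
have actsT : [acts <[g]>%g, on [set: 'cV[F]_2] | cyc_act g].
  apply/subsetP=> h hg; rewrite !inE hg.
  by apply/subsetP=> v; rewrite !inE.
have /and3P[/eqP cov /trivIsetP tI n0] := orbit_partition actsT.
apply/and3P; split.
- rewrite eqEsubset; apply/andP; split; apply/subsetP => v.
    case/bigcupP=> O; rewrite !inE => /andP[/andP[On0 /imsetP[w _ defO]] sO] vO.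
    have eqvO : orbit (cyc_act g) <[g]> v = O.
      by rewrite defO in vO *; apply: (orbit_in_eqP (subxx _)).
    rewrite eqvO sO andbT; apply: contra On0 => /eqP v0.
    by rewrite -eqvO v0 orbit_cyc_act0.
  rewrite inE => /andP[vn0 sv]; apply/bigcupP.
  exists (orbit (cyc_act g) <[g]> v); last exact: orbit_refl.
  rewrite !inE sv andbT imset_f ?inE // andbT.
  apply: contra vn0 => /eqP ov0.
  by have := orbit_refl (cyc_act g) <[g]> v; rewrite ov0 inE.
- apply/trivIsetP => A B; rewrite !inE => /andP[/andP[_ hA] _] /andP[/andP[_ hB] _].
  exact: tI.
- by apply: contra n0; rewrite !inE => /andP[/andP[]].
Qed.

Lemma card_nontrivial_orbits m :
  (#|nontrivial_orbits_of_length g m| * m)%N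
    = #|[set v | (v != 0%R) && (#|orbit (cyc_act g) <[g]> v| == m)]|.
Proof.
symmetry; apply: card_uniform_partition (nontrivial_orbits_partition m).
by move=> O; rewrite inE => /andP[_ /eqP].
Qed.

End CycAct.

(** The polynomial and [('X - gamma%:P) ^+ 2] are both monic quadratics and the second divides the
    first, so their difference [D] vanishes. Comparing coefficients avoids derivatives and covers
    characteristic 2. *)
Lemma double_root_coef (F : fieldType) (a b gamma : F) :
    (1 < mup gamma ('X^2 - a *: 'X - b%:P))%N ->
  a = gamma *+ 2 /\ b = - gamma ^+ 2.
Proof.
set P := (X in mup _ X) => mupP.
have Pn0 : P != 0.
  apply/eqP=> /(congr1 (coefp 2)); rewrite /P /coefp /= !coefE /= mulr0 !subr0.
  by move/eqP; rewrite oner_eq0.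
have := mupP; rewrite mup_geq // => dvdP.
set D := (a - gamma *+ 2) *: 'X + (b + gamma ^+ 2)%:P.
have DE : D = ('X - gamma%:P) ^+ 2 - P.
  rewrite /D /P -!mul_polyC !(rmorphB, rmorphD, rmorphXn, rmorphMn) /=; ring.
have : D = 0.
  (* [D] has size at most 2, whereas a nonzero multiple of the square has size at least 3. *)
  apply: contraTeq isT => Dn0.
  have : ('X - gamma%:P) ^+ 2 %| D by rewrite DE dvdp_sub.
  move/(dvdp_leq Dn0); rewrite size_exp_XsubC leqNgt ltnS.
  rewrite (leq_trans (size_polyD _ _)) // geq_max.
  rewrite (leq_trans (size_scale_leq _ _)) ?size_polyX //.
  by rewrite (leq_trans (size_polyC_leq1 _)).
move=> D0; have := congr1 (coefp 1) D0; have := congr1 (coefp 0) D0.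
rewrite /D /coefp /= !coefE /= mulr0 mulr1 add0r addr0.
by move=> /eqP; rewrite addr_eq0 => /eqP -> /eqP; rewrite subr_eq0 => /eqP.
Qed.

Section DoubleRoot.
Variables (F : finFieldType) (a b gamma : F).
Hypotheses (gamma0 : gamma != 0).
Hypotheses (aE : a = gamma *+ 2) (bE : b = - gamma ^+ 2).

Let N : 'M[F]_2 := Qmx a b - gamma%:M.

Lemma Qmx_nilp : N *m N = 0.
Proof.
apply/matrixP=> i j; rewrite !mxE !big_ord_recl big_ord0 !mxE aE bE.
by case: i => [[|[|//]] ?]; case: j => [[|[|//]] ?] /=; ring.
Qed.

Lemma Qmx_exp n :
  Qmx a b ^+ n = gamma ^+ n *: (1%:M + (n%:R / gamma) *: N).
Proof.
have QE : Qmx a b = gamma%:M + N by rewrite addrC subrK.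
elim: n => [|n IHn]; first by rewrite !expr0 mul0r scale0r addr0 scale1r.
rewrite exprS IHn [X in X * _]QE -[_ * _]/(_ *m _) -scalemxAr.
rewrite mulmxDr mulmx1 -scalemxAr mulmxDl Qmx_nilp addr0 mul_scalar_mx.
rewrite exprSr -scalerA; congr (_ *: _).
rewrite scalerA divfK // [RHS]scalerDr scale_scalar_mx mulr1.
rewrite scalerA mulrCA divff // mulr1 -addrA; congr (_ + _).
by rewrite -{1}[N]scale1r -scalerDl mulrSr addrC.
Qed.

Lemma Qmx_exp_fix_ker n (v : 'cV[F]_2) :
  v != 0 -> N *m v = 0 -> (Qmx a b ^+ n *m v == v) = (gamma ^+ n == 1).
Proof.
move=> vn0 Nv0; rewrite Qmx_exp -scalemxAl mulmxDl mul1mx -scalemxAl Nv0.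
rewrite scaler0 addr0 -subr_eq0 -{2}[v]scale1r -scalerBl scaler_eq0 (negPf vn0).
by rewrite orbF subr_eq0.
Qed.

Lemma Qmx_exp_fix_nker n (v : 'cV[F]_2) :
    N *m v != 0 ->
  (Qmx a b ^+ n *m v == v) = (gamma ^+ n == 1) && (n%:R == 0 :> F).
Proof.
move=> Nv0; rewrite Qmx_exp -scalemxAl mulmxDl mul1mx -scalemxAl.
have [gn1|gn1] /= := eqVneq (gamma ^+ n) 1.
  rewrite gn1 scale1r -subr_eq0 addrC addrA addNr add0r scaler_eq0 (negPf Nv0).
  by rewrite orbF mulf_eq0 invr_eq0 (negPf gamma0) orbF.
(* Multiplying the fixed-point equation by [N] kills its nilpotent term and leaves
   [gamma ^+ n *: (N *m v) = N *m v] with [N *m v] nonzero. *)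
apply: contraNF gn1 => /eqP/(congr1 (mulmx N)).
rewrite -scalemxAr mulmxDr -scalemxAr mulmxA Qmx_nilp mul0mx scaler0 addr0.
move/eqP; rewrite -subr_eq0 -{2}[N *m v]scale1r -scalerBl scaler_eq0.
by rewrite (negPf Nv0) orbF subr_eq0.
Qed.

(** The second row of [N] is [(1, - gamma)] and the first row is [gamma] times it, so only the
    second row matters. *)
Lemma Qmx_kerE (v : 'cV[F]_2) :
  (N *m v == 0) = (v ord0 ord0 == gamma * v ord_max ord0).
Proof.
have ord1E : lift ord0 ord0 = ord_max :> 'I_2 by apply: val_inj.
apply/eqP/eqP => [/matrixP/(_ ord_max ord0)|vE].
  rewrite !mxE !big_ord_recl big_ord0 ord1E !mxE /=.
  rewrite mulr0n mulr1n subr0 mul1r sub0r addr0 mulNr => /eqP.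
  by rewrite subr_eq0 => /eqP.
apply/matrixP=> i j; rewrite [j]ord1 !mxE !big_ord_recl big_ord0 ord1E !mxE vE.
by case: i => [[|[|//]] ?] /=; rewrite ?aE ?bE; ring.
Qed.

Lemma card_Qmx_ker : #|[set v : 'cV[F]_2 | N *m v == 0]| = #|F|.
Proof.
(* The kernel is the line spanned by [(gamma, 1)], parametrized by the last coordinate. *)
pose f (x : F) : 'cV[F]_2 := \col_i (if i == ord0 then gamma * x else x).
have -> : [set v : 'cV[F]_2 | N *m v == 0] = f @: [set: F].
  apply/setP=> v; rewrite inE Qmx_kerE; apply/eqP/imsetP => [vE|[x _ ->]].
    exists (v ord_max ord0) => //; apply/matrixP=> i j; rewrite [j]ord1 !mxE -vE.
    by case: i => [[|[|//]] i2] /=; congr (v _ _); apply: val_inj.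
  by rewrite !mxE.
rewrite card_imset ?cardsT // => x y /matrixP/(_ ord_max ord0).
by rewrite !mxE.
Qed.

End DoubleRoot.

Theorem mainTheorem14 (F : finFieldType) (p : nat) (hp : p \in [pchar F])
    (a b : F) (hb : b != 0) (gamma : F) (l : nat)
    (hgamma : (1 < mup gamma ('X^2 - a *: 'X - b%:P))%N)
    (hl : l.-primitive_root gamma) :
  #|nontrivial_orbits_of_length (Qgl a hb) l|%:R
    = (#|F|%:R - 1) / l%:R :> rat
  /\ #|nontrivial_orbits_of_length (Qgl a hb) (p * l)|%:R
    = #|F|%:R * (#|F|%:R - 1) / (p%:R * l%:R) :> rat.
Proof.
have [aE bE] := double_root_coef hgamma.
have gamma0 : gamma != 0.
  by apply: contra_neq hb => g0; rewrite bE g0 expr0n oppr0.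
have l_gt0 : (0 < l)%N := prim_order_gt0 hl.
have p_pr : prime p := pcharf_prime hp.
have p_gt0 := prime_gt0 p_pr.
have co_pl : coprime p l.
  (* The order of a root of unity in [F] is nonzero in [F], hence prime to [p]. *)
  by rewrite prime_coprime // (dvdn_pcharf hp); apply: prim_root_natf_neq0 hl.
set g := Qgl a hb; pose N := Qmx a b - gamma%:M.
have orbE v : v != 0 ->
    #|orbit (cyc_act g) <[g]> v| = if N *m v == 0 then l else (p * l)%N.
  move=> vn0; case: eqP => [Nv0|/eqP Nvn0]; apply: card_orbit_cycle => [|n] //.
  - by rewrite cyc_actE (Qmx_exp_fix_ker gamma0 aE bE) // (prim_order_dvd hl).
  - by rewrite muln_gt0 p_gt0.
  rewrite cyc_actE (Qmx_exp_fix_nker gamma0 aE bE) // -(prim_order_dvd hl).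
  by rewrite -(dvdn_pcharf hp) Gauss_dvd // andbC.
(* The two lengths differ, so each one singles out one side of the split by [K]. *)
have neq_lpl : (l == p * l)%N = false.
  by rewrite -{1}[l]mul1n eqn_pmul2r // ltn_eqF // prime_gt1.
pose K := [set v : 'cV[F]_2 | N *m v == 0].
have cardK : #|K| = #|F| := card_Qmx_ker aE bE.
have K0 : 0 \in K by rewrite inE mulmx0.
have F_gt0 : (0 < #|F|)%N by apply/card_gt0P; exists 0.
have l0 : l%:R != 0 :> rat by rewrite Num.Theory.pnatr_eq0 -lt0n.
have p0 : p%:R != 0 :> rat by rewrite Num.Theory.pnatr_eq0 -lt0n.
have := card_nontrivial_orbits g (p * l); have := card_nontrivial_orbits g l.
have -> : [set v | (v != 0) && (#|orbit (cyc_act g) <[g]> v| == l)] = K :\ 0.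
  apply/setP=> v; rewrite !inE; case: eqVneq => //= vn0; rewrite orbE //.
  by case: (_ *m _ == 0); rewrite ?eqxx // eq_sym neq_lpl.
(* Zero lies in [K], so the complement already excludes it; it has [q ^ 2 - q] elements, against
   [q - 1] for [K :\ 0], where [q = #|F|]. *)
have -> : [set v | (v != 0) && (#|orbit (cyc_act g) <[g]> v| == (p * l)%N)] = ~: K.
  apply/setP=> v; rewrite !inE; case: eqVneq => [->|vn0] /=; first by rewrite mulmx0 eqxx.
  by rewrite orbE //; case: (_ *m _ == 0); rewrite ?eqxx ?neq_lpl.
move=> eq1; rewrite [in RHS]cardsCs setCK card_mx cardK => eq2; split.
  apply: (canRL (mulfK l0)); rewrite -natrM eq1.
  by rewrite -[#|F|]cardK (cardsD1 0 K) K0 natrD addrC addKr.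
apply: (canRL (mulfK _)); first by rewrite mulf_neq0.
rewrite -!natrM eq2 muln1 expnS expn1 natrB ?leq_pmulr // natrM; ring.
Qed.
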